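(* Let $SO(3)$ act on the unit sphere $S^2\subset\mathbb{R}^3$. For every finite set $W\subset S^2$ there is a precoloring $c:S^2\setminus W\to\{R,B\}$ such that no extension of $c$ to a coloring $S^2\to\{R,B\}$ is $SO(3)$-distinguishing; in particular $P(W,SO(3))$ fails for every finite $W$. Assuming the axiom of choice, the same holds for every countable set $W\subset S^2$.
   Context: A coloring $c:S^2\to\{R,B\}$ is $SO(3)$-distinguishing if the only $\gamma\in SO(3)$ with $c\circ\gamma=c$ is the identity. For $W\subset S^2$ with trivial pointwise stabilizer in $SO(3)$, $P(W,SO(3))$ holds if every precoloring $S^2\setminus W\to\{R,B\}$ extends to an $SO(3)$-distinguishing coloring of $S^2$. *)

(* Defs.v *)
From Stdlib Require Import Reals.
Open Scope R_scope.

Definition pt := (R * R * R)%type.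

Definition on_sphere (p : pt) : Prop :=
  let '(x, y, z) := p in x * x + y * y + z * z = 1.

Record mat3 := Mat3 {
  m11 : R; m12 : R; m13 : R;
  m21 : R; m22 : R; m23 : R;
  m31 : R; m32 : R; m33 : R }.

Definition mat_id : mat3 := Mat3 1 0 0 0 1 0 0 0 1.

Definition mat_apply (M : mat3) (p : pt) : pt :=
  let '(x, y, z) := p in
  (m11 M * x + m12 M * y + m13 M * z,
   m21 M * x + m22 M * y + m23 M * z,
   m31 M * x + m32 M * y + m33 M * z).

Definition mat_tr (M : mat3) : mat3 :=
  Mat3 (m11 M) (m21 M) (m31 M)
       (m12 M) (m22 M) (m32 M)
       (m13 M) (m23 M) (m33 M).

Definition mat_mul (A B : mat3) : mat3 :=
  Mat3 (m11 A * m11 B + m12 A * m21 B + m13 A * m31 B)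
       (m11 A * m12 B + m12 A * m22 B + m13 A * m32 B)
       (m11 A * m13 B + m12 A * m23 B + m13 A * m33 B)
       (m21 A * m11 B + m22 A * m21 B + m23 A * m31 B)
       (m21 A * m12 B + m22 A * m22 B + m23 A * m32 B)
       (m21 A * m13 B + m22 A * m23 B + m23 A * m33 B)
       (m31 A * m11 B + m32 A * m21 B + m33 A * m31 B)
       (m31 A * m12 B + m32 A * m22 B + m33 A * m32 B)
       (m31 A * m13 B + m32 A * m23 B + m33 A * m33 B).

Definition mat_det (M : mat3) : R :=
  m11 M * (m22 M * m33 M - m23 M * m32 M)
  - m12 M * (m21 M * m33 M - m23 M * m31 M)
  + m13 M * (m21 M * m32 M - m22 M * m31 M).

Definition in_SO3 (M : mat3) : Prop :=
  mat_mul (mat_tr M) M = mat_id /\ mat_det M = 1.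

(* Colors: true = R (red), false = B (blue).  A coloring of S^2 is a function
   pt -> bool of which only the values on S^2 matter. *)
Definition coloring := pt -> bool.

Definition preserves (c : coloring) (M : mat3) : Prop :=
  forall p, on_sphere p -> c (mat_apply M p) = c p.

Definition distinguishing (c : coloring) : Prop :=
  forall M, in_SO3 M -> preserves c M -> M = mat_id.

Definition extends (W : pt -> Prop) (c0 c : coloring) : Prop :=
  forall p, on_sphere p -> ~ W p -> c p = c0 p.

Definition trivial_pointwise_stab (W : pt -> Prop) : Prop :=
  forall M, in_SO3 M -> (forall p, W p -> mat_apply M p = p) -> M = mat_id.

Definition P_prop (W : pt -> Prop) : Prop :=
  forall c0 : coloring, exists c, extends W c0 c /\ distinguishing c.

Definition subset_sphere (W : pt -> Prop) : Prop := forall p, W p -> on_sphere p.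

Definition finite_set (W : pt -> Prop) : Prop :=
  exists l : list pt, forall p, W p -> List.In p l.

Definition countable_set (W : pt -> Prop) : Prop :=
  exists f : nat -> pt, forall p, W p -> exists n, f n = p.

(* Main.v *)
(** Write a rotation about the [x]-axis with entries [3/5, 4/5] as [b] and put
    [g_s = a(t_s) b a(t_s)^-1], where [a(t)] is the rotation by [t] about the
    [z]-axis and [s] ranges over all 0-1 sequences, read as colorings of the
    enumerated set [W].  Suppose the angles [t_s] are so generic that no
    nonempty reduced word in the [g_s] maps a point of [W] to a point of [W].
    Then the graph with edges [p -- g_s p] is a tree around each [w] in [W], and
    deleting [w] leaves one branch for every letter [g_s^{+-1}].  Color this
    branch with [s(w)], and everything else blue: whatever coloring [s] is put
    on [W], the result is invariant under [g_s].

    The angles come from a Cantor scheme: a condition "word maps [w] to [w']"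
    is closed, and it has empty interior.  For the latter, take the angles in
    the multiples of a small [delta] with [tan (delta/2) = 1/(5N+2)]; all
    matrices become rational, of rank one modulo 5 after clearing denominators,
    and a reduced word moves the north pole off the [z]-axis.  Such a word
    cannot map [w] to [w'] for all small simultaneous shifts of the angles. *)

Require Import Defs.
From Stdlib Require Import Reals Lra Lia ZArith List Classical ClassicalEpsilon
  FunctionalExtensionality.
From Coquelicot Require Import Coquelicot.
Import ListNotations.
Open Scope R_scope.

(** * Words in conjugates of a fixed rotation *)

Definition rz (t : R) (p : pt) : pt :=
  let '(x, y, z) := p in (cos t * x - sin t * y, sin t * x + cos t * y, z).

Definition rx (e : bool) (p : pt) : pt :=
  let '(x, y, z) := p in
  let s := if e then 4 / 5 else - (4 / 5) in
  (x, 3 / 5 * y - s * z, s * y + 3 / 5 * z).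

Definition gen (t : R) (e : bool) (p : pt) : pt := rz t (rx e (rz (- t) p)).

(** The index type stays open: words are indexed by nodes in [nat] during the Cantor scheme and by
    0-1 sequences in the limit. The head letter acts last. *)
Fixpoint act {J : Type} (t : J -> R) (L : list (J * bool)) (p : pt) : pt :=
  match L with
  | [] => p
  | (u, e) :: L' => gen (t u) e (act t L' p)
  end.

Fixpoint reduced {J : Type} (L : list (J * bool)) : Prop :=
  match L with
  | [] => True
  | (u, e) :: L' =>
      match L' with [] => True | (u', e') :: _ => u = u' -> e = e' end
      /\ reduced L'
  end.

Definition inner (p q : pt) : R :=
  let '(x, y, z) := p in let '(x', y', z') := q in x * x' + y * y' + z * z'.

Definition opp (p : pt) : pt := let '(x, y, z) := p in (- x, - y, - z).

Definition pole : pt := (0, 0, 1).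

Lemma pt_eq (x y z x' y' z' : R) :
  x = x' -> y = y' -> z = z' -> (x, y, z) = (x', y', z') :> pt.
Proof. now intros -> -> ->. Qed.

Lemma cos_sin_sqr (t : R) : cos t * cos t = 1 - sin t * sin t.
Proof. generalize (sin2_cos2 t); unfold Rsqr; lra. Qed.

Lemma rz_add (a b : R) (p : pt) : rz a (rz b p) = rz (a + b) p.
Proof.
  destruct p as [[x y] z]; unfold rz; rewrite cos_plus, sin_plus.
  apply pt_eq; ring.
Qed.

Lemma rz_0 (p : pt) : rz 0 p = p.
Proof.
  destruct p as [[x y] z]; unfold rz; rewrite cos_0, sin_0; apply pt_eq; ring.
Qed.

Lemma rz_inner (t : R) (p q : pt) : inner (rz t p) (rz t q) = inner p q.
Proof.
  destruct p as [[x y] z], q as [[x' y'] z']; simpl.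
  ring_simplify; replace (cos t ^ 2) with (1 - sin t * sin t)
    by (rewrite <- cos_sin_sqr; ring); ring.
Qed.

Lemma rx_inner (e : bool) (p q : pt) : inner (rx e p) (rx e q) = inner p q.
Proof. destruct p as [[x y] z], q as [[x' y'] z'], e; simpl; field. Qed.

Lemma rx_cancel (e : bool) (p : pt) : rx (negb e) (rx e p) = p.
Proof. destruct p as [[x y] z], e; simpl; apply pt_eq; field. Qed.

Lemma gen_inner (t : R) (e : bool) (p q : pt) :
  inner (gen t e p) (gen t e q) = inner p q.
Proof. unfold gen; now rewrite rz_inner, rx_inner, rz_inner. Qed.

Lemma gen_cancel (t : R) (e : bool) (p : pt) : gen t (negb e) (gen t e p) = p.
Proof.
  unfold gen; rewrite rz_add, Rplus_opp_l, rz_0, rx_cancel, rz_add, Rplus_opp_r.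
  apply rz_0.
Qed.

Lemma gen_opp (t : R) (e : bool) (p : pt) : gen t e (opp p) = opp (gen t e p).
Proof. destruct p as [[x y] z], e; unfold gen; simpl; apply pt_eq; ring. Qed.

Lemma on_sphere_inner (p : pt) : on_sphere p <-> inner p p = 1.
Proof. destruct p as [[x y] z]; simpl; tauto. Qed.

Lemma act_inner {J : Type} (t : J -> R) (L : list (J * bool)) (p q : pt) :
  inner (act t L p) (act t L q) = inner p q.
Proof.
  induction L as [|[u e] L IH]; simpl; [easy|]. now rewrite gen_inner.
Qed.

Lemma act_opp {J : Type} (t : J -> R) (L : list (J * bool)) (p : pt) :
  act t L (opp p) = opp (act t L p).
Proof. induction L as [|[u e] L IH]; simpl; [easy|]. now rewrite IH, gen_opp. Qed.

Lemma act_inj {J : Type} (t : J -> R) (L : list (J * bool)) (p q : pt) :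
  act t L p = act t L q -> p = q.
Proof.
  induction L as [|[u e] L IH]; simpl; [easy|]. intros H; apply IH.
  apply (f_equal (gen (t u) (negb e))) in H. now rewrite !gen_cancel in H.
Qed.

(** A common shift of the angles conjugates every generator by the same rotation about the axis, and
    the inner conjugations telescope. *)
Lemma act_shift {J : Type} (t : J -> R) (c : R) (L : list (J * bool)) (p : pt) :
  act (fun u => t u + c) L p = rz c (act t L (rz (- c) p)).
Proof.
  induction L as [|[u e] L IH]; simpl.
  - now rewrite rz_add, Rplus_opp_r, rz_0.
  - rewrite IH; unfold gen; rewrite !rz_add.
    replace (- (t u + c) + c) with (- t u) by ring.
    now rewrite (Rplus_comm c).
Qed.

(** * Reduced words with commensurable angles move the pole *)

(* Residues modulo 5 of a multiple of the vector: the slopes 3 and 2 are the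
   images of the degenerate matrices [5 rx true] and [5 rx false], and likewise
   for [rz]. *)
Definition slope (e : bool) : Z := if e then 3%Z else 2%Z.

(** After scaling, the residue vector spans the line of (0, 1, [slope e]), the image of [5 rx e]
    modulo 5. [N] may be divisible by 5. *)
Definition in_plane_yz (e : bool) (p : pt) : Prop :=
  exists N X Y Z : Z,
    (IZR N * fst (fst p) = IZR X /\ IZR N * snd (fst p) = IZR Y /\
     IZR N * snd p = IZR Z) /\
    (X mod 5 = 0 /\ Y mod 5 <> 0 /\ Z mod 5 = (slope e * Y) mod 5)%Z.

Definition in_plane_xy (e : bool) (p : pt) : Prop :=
  exists N X Y Z : Z,
    (IZR N * fst (fst p) = IZR X /\ IZR N * snd (fst p) = IZR Y /\
     IZR N * snd p = IZR Z) /\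
    (Z mod 5 = 0 /\ X mod 5 <> 0 /\ Y mod 5 = (slope e * X) mod 5)%Z.

Lemma rx_pole (e : bool) : in_plane_yz e (rx e pole).
Proof.
  destruct e; [exists 5%Z, 0%Z, (-4)%Z, 3%Z | exists 5%Z, 0%Z, 4%Z, 3%Z];
    (split; [simpl; repeat split; field | repeat split; discriminate]).
Qed.

Ltac mod5 :=
  unfold slope in *; repeat split; try intro;
  Z.div_mod_to_equations; lia.

(** Modulo 5 the image line of [5 rx e] is fixed by it with eigenvalue 1. Its kernel in the yz-plane
    is the image line of the opposite sign, so equal signs are essential. *)
Lemma rx_yz (e : bool) (p : pt) : in_plane_yz e p -> in_plane_yz e (rx e p).
Proof.
  destruct p as [[x y] z]; intros (N & X & Y & Z & (Hx & Hy & Hz) & H).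
  cbn [fst snd] in *.
  exists (5 * N)%Z, (5 * X)%Z, (3 * Y - (if e then 4 else -4) * Z)%Z,
    ((if e then 4 else -4) * Y + 3 * Z)%Z.
  split; [| destruct e; mod5].
  destruct e; cbn [rx fst snd]; rewrite ?minus_IZR, ?plus_IZR, ?mult_IZR,
    <- Hx, <- Hy, <- Hz; repeat split; field.
Qed.

(** With [Z] zero and [Y] nonzero modulo 5, the vector is outside the kernel of [5 rx e] for either
    sign. *)
Lemma rx_xy (e e' : bool) (p : pt) : in_plane_xy e' p -> in_plane_yz e (rx e p).
Proof.
  destruct p as [[x y] z]; intros (N & X & Y & Z & (Hx & Hy & Hz) & H).
  cbn [fst snd] in *.
  exists (5 * N)%Z, (5 * X)%Z, (3 * Y - (if e then 4 else -4) * Z)%Z,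
    ((if e then 4 else -4) * Y + 3 * Z)%Z.
  split; [| destruct e, e'; mod5].
  destruct e; cbn [rx fst snd]; rewrite ?minus_IZR, ?plus_IZR, ?mult_IZR,
    <- Hx, <- Hy, <- Hz; repeat split; field.
Qed.

(* [tan (d / 2) = 1 / (5 k + 2)]. *)
Definition rational_angle (k : nat) (d : R) : Prop :=
  let p := 5 * INR k + 2 in
  cos d = (p * p - 1) / (p * p + 1) /\ sin d = 2 * p / (p * p + 1).

Lemma exists_small_rational_angle (eps : R) :
  0 < eps -> exists (k : nat) (d : R), 0 < d < eps /\ rational_angle k d.
Proof.
  (* Half of [eps] pays for the doubled angle; the cap at 1, below [PI / 2], makes [atan (tan h)]
     equal to [h]. *)
  intros Heps. set (h := Rmin (eps / 2) 1).
  assert (Hh : 0 < h <= eps / 2 /\ h <= 1).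
  { unfold h; repeat split; [apply Rmin_glb_lt; lra | apply Rmin_l | apply Rmin_r]. }
  assert (HPI := PI2_1).
  assert (Htan : 0 < tan h) by (apply tan_gt_0; lra).
  destruct (archimed_cor1 (tan h) Htan) as [k [Hk Hk0]].
  assert (Hk1 : 1 <= INR k) by (apply (le_INR 1); lia).
  set (p := 5 * INR k + 2).
  assert (Hp : 0 < / p) by (apply Rinv_0_lt_compat; unfold p; lra).
  exists k, (2 * atan (/ p)).
  assert (Hpk : / p < / INR k).
  { apply Rinv_lt_contravar; [|unfold p; lra].
    apply Rmult_lt_0_compat; unfold p; lra. }
  split; [split|].
  - apply atan_increasing in Hp; rewrite atan_0 in Hp; lra.
  - assert (H : atan (/ p) < atan (tan h)) by (apply atan_increasing; lra).
    rewrite atan_tan in H; lra.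
  - assert (Hpos : 0 < 1 + (/ p)²) by (generalize (Rle_0_sqr (/ p)); lra).
    assert (Hs := sqrt_sqrt _ (Rlt_le _ _ Hpos)).
    assert (Hs0 := sqrt_lt_R0 _ Hpos).
    unfold Rsqr in Hs, Hs0, Hpos.
    assert (Hp0 : p <> 0) by (unfold p; lra).
    assert (Hp1 : p * p + 1 <> 0) by nra.
    unfold rational_angle; fold p.
    rewrite cos_2a, sin_2a, cos_atan, sin_atan; unfold Rsqr.
    set (q := sqrt (1 + / p * / p)) in *.
    assert (Hq : / q * / q = p * p / (p * p + 1)).
    { rewrite <- Rinv_mult, Hs; field; auto. }
    assert (Hq0 : q <> 0) by lra. split.
    + transitivity ((1 - / p * / p) * (/ q * / q)); [field; auto|].
      rewrite Hq; field; auto.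
    + transitivity (2 * / p * (/ q * / q)); [field; auto|].
      rewrite Hq; field; auto.
Qed.

Definition signed (e : bool) (d : R) : R := if e then d else - d.

(** For p = 5k + 2 the common denominator p^2 + 1 vanishes modulo 5, which kills the third
    coordinate, while p^2 - 1 and 2p become 3 and 4. The cleared rotation thus has the same
    degenerate block as [5 rx]. *)
Ltac rational_angle_step Hx Hy Hz k N X Y Z e :=
  exists (((5 * Z.of_nat k + 2) * (5 * Z.of_nat k + 2) + 1) * N)%Z,
    (((5 * Z.of_nat k + 2) * (5 * Z.of_nat k + 2) - 1) * X
     - (if e then 2 else -2) * (5 * Z.of_nat k + 2) * Y)%Z,
    ((if e then 2 else -2) * (5 * Z.of_nat k + 2) * X
     + ((5 * Z.of_nat k + 2) * (5 * Z.of_nat k + 2) - 1) * Y)%Z,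
    (((5 * Z.of_nat k + 2) * (5 * Z.of_nat k + 2) + 1) * Z)%Z;
  split;
  [ destruct e; cbn [signed rz fst snd];
    rewrite ?cos_neg, ?sin_neg;
    repeat match goal with H : cos _ = _ |- _ => rewrite H; clear H
                         | H : sin _ = _ |- _ => rewrite H; clear H end;
    repeat first [ rewrite minus_IZR | rewrite plus_IZR | rewrite mult_IZR ];
    rewrite <- ?INR_IZR_INZ, <- Hx, <- Hy, <- Hz;
    assert (5 * INR k + 2 <> 0) by (generalize (pos_INR k); lra);
    repeat split; field; nra
  | idtac ].

Lemma rz_yz (k : nat) (d : R) (e e' : bool) (p : pt) :
  rational_angle k d -> in_plane_yz e' p -> in_plane_xy e (rz (signed e d) p).
Proof.
  intros [Hc Hs].
  destruct p as [[x y] z]; intros (N & X & Y & Z & (Hx & Hy & Hz) & H).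
  cbn [fst snd] in *. rational_angle_step Hx Hy Hz k N X Y Z e.
  destruct e, e'; mod5.
Qed.

Lemma rz_xy (k : nat) (d : R) (e : bool) (p : pt) :
  rational_angle k d -> in_plane_xy e p -> in_plane_xy e (rz (signed e d) p).
Proof.
  intros [Hc Hs].
  destruct p as [[x y] z]; intros (N & X & Y & Z & (Hx & Hy & Hz) & H).
  cbn [fst snd] in *. rational_angle_step Hx Hy Hz k N X Y Z e.
  destruct e; mod5.
Qed.

(** The rotation splits into |m| rotations of one sign: the first passes from the yz-type to the
    xy-type, and the others preserve the slope, as no opposite sign occurs. *)
Lemma rz_multiple_yz (k : nat) (d : R) (m : Z) (e : bool) (p : pt) :
  rational_angle k d -> m <> 0%Z -> in_plane_yz e p ->
  exists e', in_plane_xy e' (rz (IZR m * d) p).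
Proof.
  intros Hd Hm Hp.
  assert (Hpow : forall e' n, in_plane_xy e' (rz (INR (S n) * signed e' d) p)).
  { intros e' n; induction n as [|n IH].
    - rewrite Rmult_1_l; eapply rz_yz; eassumption.
    - rewrite S_INR, Rmult_plus_distr_r, Rmult_1_l, Rplus_comm, <- rz_add.
      eapply rz_xy; eassumption. }
  destruct (Z.lt_total m 0) as [H|[H|H]]; [| contradiction |].
  - exists false. specialize (Hpow false (Z.to_nat (- m) - 1)%nat).
    replace (S (Z.to_nat (- m) - 1)) with (Z.to_nat (- m)) in Hpow by lia.
    rewrite INR_IZR_INZ, Z2Nat.id, opp_IZR in Hpow by lia.
    simpl in Hpow. now replace (- IZR m * - d) with (IZR m * d) in Hpow by ring.
  - exists true. specialize (Hpow true (Z.to_nat m - 1)%nat).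
    replace (S (Z.to_nat m - 1)) with (Z.to_nat m) in Hpow by lia.
    now rewrite INR_IZR_INZ, Z2Nat.id in Hpow by lia.
Qed.

Lemma rz_pole (t : R) : rz t pole = pole.
Proof. apply pt_eq; ring. Qed.

(** The vector is followed in the frame of the latest letter. Between letters of different angle, a
    nonzero multiple of [d] leads to the xy-type and the next [rx] back, whatever the signs; between
    letters of equal angle, reducedness makes the signs agree. *)
Lemma act_pole_yz {J : Type} (t : J -> R) (m : J -> Z) (k : nat) (d : R)
    (u : J) (e : bool) (L : list (J * bool)) :
  rational_angle k d ->
  (forall v, In v (map fst ((u, e) :: L)) -> t v = IZR (m v) * d) ->
  (forall v w, In v (map fst ((u, e) :: L)) -> In w (map fst ((u, e) :: L)) ->
     m v = m w -> v = w) ->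
  reduced ((u, e) :: L) ->
  in_plane_yz e (rz (- t u) (act t ((u, e) :: L) pole)).
Proof.
  intros Hd. revert u e.
  induction L as [|[u' e'] L IH]; intros u e Ht Hm Hred.
  - cbn [act]; unfold gen.
    rewrite rz_pole, rz_add, Rplus_opp_l, rz_0; apply rx_pole.
  - change (act t ((u, e) :: (u', e') :: L) pole)
      with (gen (t u) e (act t ((u', e') :: L) pole)).
    unfold gen; rewrite rz_add, Rplus_opp_l, rz_0.
    set (q := act t ((u', e') :: L) pole).
    assert (Hq : in_plane_yz e' (rz (- t u') q)).
    { apply IH; [| | apply Hred].
      - intros v Hv; apply Ht; now right.
      - intros v w Hv Hw; apply Hm; now right. }
    destruct (Z.eq_dec (m u' - m u) 0) as [H0|H0].
    + assert (Huu : u = u') by (apply Hm; [now left | now right; left | lia]).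
      destruct Hred as [He _]. rewrite (He Huu), Huu. now apply rx_yz.
    + destruct (rz_multiple_yz k d _ e' _ Hd H0 Hq) as [e'' H].
      rewrite rz_add in H. apply rx_xy with e''.
      replace (- t u) with (IZR (m u' - m u) * d + - t u'); [easy|].
      rewrite (Ht u), (Ht u'), minus_IZR; [ring | now right; left | now left].
Qed.

Lemma yz_off_axis (e : bool) (t : R) (p : pt) :
  in_plane_yz e (rz t p) -> fst (fst p) * fst (fst p) + snd (fst p) * snd (fst p) <> 0.
Proof.
  destruct p as [[x y] z]; intros (N & X & Y & Z & (_ & Hy & _) & _ & HY & _) H.
  cbn [rz fst snd] in *.
  assert (x = 0 /\ y = 0) as [-> ->] by (split; nra).
  apply HY. rewrite !Rmult_0_r, Rplus_0_r, Rmult_0_r in Hy.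
  apply eq_IZR in Hy; now subst.
Qed.

(** * Perturbing the angles *)

(** Closed balls for the uniform distance, so that limits of the Cantor scheme stay inside them. *)
Definition close {J : Type} (t t' : J -> R) (r : R) : Prop :=
  forall u, Rabs (t' u - t u) <= r.

(** A line meets the unit circle in at most two points, and the angles 0, h, 2h give three. *)
Lemma trig_line_const (A B C h : R) :
  0 < h < 1 ->
  A = C -> A * cos h + B * sin h = C -> A * cos (2 * h) + B * sin (2 * h) = C ->
  A = 0 /\ B = 0.
Proof.
  intros Hh <- H1 H2. rewrite cos_2a_sin, sin_2a in H2.
  assert (Hs : 0 < sin h) by (apply sin_pos_tech; lra).
  assert (Hc : cos h < 1).
  { assert (Hcs := cos_sin_sqr h).
    destruct (Rlt_or_le (cos h) 1); [easy|nra]. }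
  assert (H3 : A * sin h = B * cos h).
  { apply Rmult_eq_reg_l with (2 * sin h); [|lra].
    lra. }
  assert (HA : A * (1 - cos h) = 0).
  { transitivity (A * (sin h * sin h) - cos h * (A - A * cos h)).
    - replace (sin h * sin h) with (1 - cos h * cos h)
        by (rewrite cos_sin_sqr; ring). ring.
    - replace (A - A * cos h) with (B * sin h) by lra.
      rewrite <- Rmult_assoc, H3; ring. }
  assert (A = 0) by (apply Rmult_integral in HA; lra).
  split; [easy|]. subst. assert (H4 : B * sin h = 0) by lra.
  apply Rmult_integral in H4; lra.
Qed.

Lemma rz_fixed_axis (h x y z : R) :
  0 < h < 1 -> rz h (x, y, z) = (x, y, z) -> x = 0 /\ y = 0.
Proof.
  intros Hh H; injection H as H1 H2.
  assert (Hs : 0 < sin h) by (apply sin_pos_tech; lra).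
  (* This is the third coordinate of the cross product of the vector with its rotate. *)
  assert (E : (x * x + y * y) * sin h = 0).
  { transitivity (x * (sin h * x + cos h * y) - y * (cos h * x - sin h * y)); [ring|].
    rewrite H1, H2; ring. }
  apply Rmult_integral in E; split; nra.
Qed.

(* The inner product with the image of the pole gives, along the shifts, a
   function [A cos c + B sin c] that would have to be constant. *)
Lemma shift_moves {J : Type} (t : J -> R) (L : list (J * bool)) (w w' : pt) (h : R) :
  0 < h < 1 -> on_sphere w ->
  fst (fst (act t L pole)) * fst (fst (act t L pole))
    + snd (fst (act t L pole)) * snd (fst (act t L pole)) <> 0 ->
  exists c, 0 <= c <= 2 * h /\ act (fun u => t u + c) L w <> w'.
Proof.
  intros Hh Hw Hn. apply NNPP; intros Hno.
  assert (E : forall c, 0 <= c <= 2 * h -> act t L (rz (- c) w) = rz (- c) w').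
  { intros c Hc. assert (H : act (fun u => t u + c) L w = w').
    { apply NNPP; intros H; apply Hno; now exists c. }
    rewrite act_shift in H. rewrite <- H, rz_add, Rplus_opp_l. now rewrite rz_0. }
  assert (I : forall c, 0 <= c <= 2 * h ->
            inner (rz (- c) w') (act t L pole) = inner w pole).
  { intros c Hc. rewrite <- E, act_inner by easy.
    rewrite <- (rz_pole (- c)) at 1. apply rz_inner. }
  assert (I0 := I 0). assert (I1 := I h). assert (I2 := I (2 * h)).
  assert (E0 := E 0). assert (E1 := E h). clear E I Hno.
  rewrite Ropp_0, rz_0 in I0. rewrite Ropp_0, !rz_0 in E0.
  destruct (act t L pole) as [[n1 n2] n3] eqn:En.
  destruct w as [[x y] z], w' as [[x' y'] z'].
  cbn [rz inner pole fst snd] in Hn, I0, I1, I2.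
  rewrite cos_neg, sin_neg in I1, I2.
  destruct (trig_line_const (n1 * x' + n2 * y') (n1 * y' - n2 * x')
              (z - n3 * z') h) as [HA HB]; [lra | nra | nra | nra |].
  assert (Hprod : (n1 * n1 + n2 * n2) * (x' * x' + y' * y') = 0).
  { replace ((n1 * n1 + n2 * n2) * (x' * x' + y' * y'))
      with ((n1 * x' + n2 * y') * (n1 * x' + n2 * y')
            + (n1 * y' - n2 * x') * (n1 * y' - n2 * x')) by ring.
    rewrite HA, HB; ring. }
  apply Rmult_integral in Hprod as [|Hxy']; [contradiction|].
  (* The target is now on the axis and fixed by all shifts. Injectivity of the word puts [w] on the
     axis too, so [w] is the pole or its opposite, and the word would keep the pole on the axis. *)
  assert (x' = 0 /\ y' = 0) as [-> ->] by (split; nra).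
  specialize (E0 ltac:(lra)). specialize (E1 ltac:(lra)).
  assert (Hfix : rz h (x, y, z) = (x, y, z)).
  { replace (rz (- h) (0, 0, z')) with (0, 0, z') in E1 by (apply pt_eq; ring).
    rewrite <- E0 in E1. apply act_inj in E1.
    rewrite <- E1 at 1. now rewrite rz_add, Rplus_opp_r, rz_0. }
  destruct (rz_fixed_axis h x y z Hh Hfix) as [-> ->].
  simpl in Hw.
  assert (Hz : (z - 1) * (z + 1) = 0) by lra.
  apply Rmult_integral in Hz as [Hz|Hz].
  - replace z with 1 in E0 by lra. fold pole in E0. rewrite En in E0.
    injection E0 as -> -> _; apply Hn; ring.
  - replace z with (- 1) in E0 by lra.
    replace (0, 0, - 1) with (opp pole) in E0 by (apply pt_eq; ring).
    rewrite act_opp, En in E0. injection E0 as E01 E02 _; apply Hn.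
    replace n1 with 0 by lra; replace n2 with 0 by lra; ring.
Qed.

Lemma fst_bound (L : list (nat * bool)) :
  exists M, (0 < M)%nat /\ forall u, In u (map fst L) -> (u < M)%nat.
Proof.
  induction L as [|[u e] L [M [HM H]]]; [exists 1%nat; split; [lia | easy]|].
  exists (u + M + 1)%nat; split; [lia|].
  intros v [<-|Hv]; [simpl; lia|]. specialize (H v Hv); lia.
Qed.

(** Rounding the angles to distinct multiples of a small [d] moves the pole off the axis; a further
    common shift then separates [w'] from the image of [w]. *)
Lemma bad_angles_nowhere_dense (t : nat -> R) (eps : R)
    (L : list (nat * bool)) (w w' : pt) :
  0 < eps -> L <> [] -> reduced L -> on_sphere w ->
  exists t', close t t' eps /\ act t' L w <> w'.
Proof.
  intros Heps HL Hred Hw.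
  destruct (fst_bound L) as [M [HM0 HM]].
  assert (HMR : 1 <= INR M) by (apply (le_INR 1); lia).
  (* Rounding to the grid of step [INR M * d] and adding the offset [u * d] costs at most
     [2 * INR M * d], hence less than [eps / 2]. The other half is left for the shift. *)
  destruct (exists_small_rational_angle (eps / (4 * INR M))) as (k & d & Hd & Hcom).
  { apply Rdiv_lt_0_compat; lra. }
  assert (Hd4 : 4 * (INR M * d) < eps).
  { destruct Hd as [_ Hd]. apply (Rmult_lt_compat_r (4 * INR M)) in Hd; [|lra].
    unfold Rdiv in Hd; rewrite Rmult_assoc, Rinv_l in Hd; lra. }
  assert (HMd : 0 < INR M * d) by (apply Rmult_lt_0_compat; lra).
  (* Distinct residues modulo [M] make the multiples of [d] distinct. *)
  set (m := fun u => (Z.of_nat M * up (t u / (INR M * d)) + Z.of_nat u)%Z).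
  set (t0 := fun u => if (u <? M)%nat then IZR (m u) * d else t u).
  assert (Hclose : close t t0 (eps / 2)).
  { intros u; unfold t0. destruct (Nat.ltb_spec u M) as [Hu|Hu].
    - unfold m. rewrite plus_IZR, mult_IZR, <- !INR_IZR_INZ.
      destruct (archimed (t u / (INR M * d))) as [Ha Hb].
      set (a := IZR (up (t u / (INR M * d)))) in *.
      assert (Et : t u = t u / (INR M * d) * (INR M * d)) by (field; lra).
      set (b := t u / (INR M * d)) in *.
      assert (HuM : 0 <= INR u <= INR M)
        by (split; [apply pos_INR | apply le_INR; lia]).
      rewrite Et. replace ((INR M * a + INR u) * d - b * (INR M * d))
        with ((a - b) * (INR M * d) + INR u * d) by ring.
      assert (0 <= INR u * d <= INR M * d) by (split; nra).
      assert (0 <= (a - b) * (INR M * d) <= INR M * d) by (split; nra).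
      rewrite Rabs_pos_eq; lra.
    - rewrite Rminus_diag, Rabs_R0; lra. }
  assert (Hoff : fst (fst (act t0 L pole)) * fst (fst (act t0 L pole))
    + snd (fst (act t0 L pole)) * snd (fst (act t0 L pole)) <> 0).
  { destruct L as [|[u e] L]; [contradiction|].
    apply (yz_off_axis e (- t0 u)). apply (act_pole_yz t0 m k d); try easy.
    - intros v Hv; unfold t0. now rewrite (proj2 (Nat.ltb_lt v M) (HM v Hv)).
    - intros v v' Hv Hv' E. apply HM in Hv, Hv'. unfold m in E.
      apply (f_equal (fun z => z mod Z.of_nat M)%Z) in E.
      rewrite !(Z.add_comm (_ * _)), !(Z.mul_comm (Z.of_nat M)), !Z_mod_plus_full,
        !Z.mod_small in E by lia. lia. }
  set (h := Rmin (eps / 4) (1 / 2)).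
  assert (Hh : 0 < h <= eps / 4 /\ h <= 1 / 2).
  { unfold h; repeat split; [apply Rmin_glb_lt; lra | apply Rmin_l | apply Rmin_r]. }
  destruct (shift_moves t0 L w w' h) as (c & Hc & H); [lra | easy | easy |].
  exists (fun u => t0 u + c); split; [|easy].
  intros u. specialize (Hclose u). cbv beta.
  replace (t0 u + c - t u) with ((t0 u - t u) + c) by ring.
  eapply Rle_trans; [apply Rabs_triang|]. rewrite (Rabs_pos_eq c); lra.
Qed.

Lemma act_continuous {J : Type} (L : list (J * bool)) (p : pt) (t : J -> R) :
  continuous (fun T : J -> R => fst (fst (act T L p))) t /\
  continuous (fun T : J -> R => snd (fst (act T L p))) t /\
  continuous (fun T : J -> R => snd (act T L p)) t.
Proof.
  induction L as [|[u e] L (Hx & Hy & Hz)]; simpl.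
  - split; [|split]; apply continuous_const.
  - assert (Hu : continuous (fun T : J -> R => T u) t).
    { apply filterlim_locally; intros eps. exists eps; intros T HT; apply HT. }
    assert (Hc : continuous (fun T : J -> R => cos (T u)) t).
    { apply (continuous_comp (fun T : J -> R => T u) cos); [easy|].
      apply continuous_cos. }
    assert (Hs : continuous (fun T : J -> R => sin (T u)) t).
    { apply (continuous_comp (fun T : J -> R => T u) sin); [easy|].
      apply continuous_sin. }
    set (s := if e then 4 / 5 else - (4 / 5)).
    set (x := fun T : J -> R => fst (fst (act T L p))) in *.
    set (y := fun T : J -> R => snd (fst (act T L p))) in *.
    set (z := fun T : J -> R => snd (act T L p)) in *.
    assert (Hplus : forall F G : (J -> R) -> R, continuous F t -> continuous G t ->
              continuous (fun T => F T + G T) t)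
      by (intros F G; apply (continuous_plus (V := R_NormedModule))).
    assert (Hmult : forall F G : (J -> R) -> R, continuous F t -> continuous G t ->
              continuous (fun T => F T * G T) t)
      by (intros F G; apply (continuous_mult (K := R_AbsRing))).
    assert (Hconst : forall a : R, continuous (fun _ : J -> R => a) t)
      by (intros a; apply continuous_const).
    (* Intermediate coordinates after the inner [rz] and after [rx]; differences are written as sums
       with negative factors so that [Hplus] and [Hmult] suffice. *)
    set (x1 := fun T : J -> R => cos (T u) * x T + sin (T u) * y T).
    set (y1 := fun T : J -> R => - 1 * (sin (T u) * x T) + cos (T u) * y T).
    set (y2 := fun T : J -> R => 3 / 5 * y1 T + - s * z T).
    assert (E : forall T : J -> R,
      (cos (T u) * x1 T + - 1 * (sin (T u) * y2 T),
       sin (T u) * x1 T + cos (T u) * y2 T,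
       s * y1 T + 3 / 5 * z T) = gen (T u) e (act T L p)).
    { intros T; unfold y2, x1, y1, x, y, z, gen, s.
      destruct (act T L p) as [[a b] c].
      cbn [rz rx fst snd]; rewrite cos_neg, sin_neg; cbv zeta.
      apply pt_eq; ring. }
    assert (Hx1 : continuous x1 t) by (apply Hplus; now apply Hmult).
    assert (Hy1 : continuous y1 t)
      by (apply Hplus; apply Hmult; auto).
    assert (Hy2 : continuous y2 t) by (apply Hplus; now apply Hmult).
    clearbody x y z x1 y1 y2 s.
    split; [|split].
    + apply continuous_ext
        with (fun T : J -> R => cos (T u) * x1 T + - 1 * (sin (T u) * y2 T)).
      * intros T; now rewrite <- E.
      * apply Hplus; apply Hmult; auto.
    + apply continuous_ext
        with (fun T : J -> R => sin (T u) * x1 T + cos (T u) * y2 T).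
      * intros T; now rewrite <- E.
      * apply Hplus; apply Hmult; auto.
    + apply continuous_ext with (fun T : J -> R => s * y1 T + 3 / 5 * z T).
      * intros T; now rewrite <- E.
      * apply Hplus; apply Hmult; auto.
Qed.

Lemma bad_angles_closed {J : Type} (L : list (J * bool)) (w w' : pt) (t : J -> R) :
  act t L w <> w' ->
  exists r, 0 < r /\ forall T, close t T r -> act T L w <> w'.
Proof.
  intros H. destruct (act_continuous L w t) as (Hx & Hy & Hz).
  destruct w' as [[x' y'] z'].
  assert (sep : forall (F : (J -> R) -> R) (a : R), continuous F t -> F t <> a ->
    exists r, 0 < r /\ forall T, close t T r -> F T <> a).
  { intros F a HF Ha.
    assert (Hpos : 0 < Rabs (F t - a)) by (apply Rabs_pos_lt; lra).
    destruct (proj1 (filterlim_locally F (F t)) HF (mkposreal _ Hpos)) as [r Hr].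
    (* Halving passes from the open ball of the uniform structure to the closed condition
       [close]. *)
    exists (r / 2). assert (Hr0 := cond_pos r). split; [lra|].
    intros T HT Hn. assert (HB : ball t r T).
    { intros u. change (Rabs (T u - t u) < r). specialize (HT u); lra. }
    specialize (Hr T HB). change (Rabs (F T - F t) < Rabs (F t - a)) in Hr.
    rewrite Hn, Rabs_minus_sym in Hr; lra. }
  destruct (classic (fst (fst (act t L w)) = x')) as [Ex|Ex];
    [destruct (classic (snd (fst (act t L w)) = y')) as [Ey|Ey];
      [destruct (classic (snd (act t L w) = z')) as [Ez|Ez] |] |].
  - exfalso; apply H. rewrite (surjective_pairing (act t L w)),
      (surjective_pairing (fst (act t L w))). now apply pt_eq.
  - destruct (sep _ _ Hz Ez) as (r & Hr & HT). exists r; split; [easy|].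
    intros T HTc E; apply (HT T HTc); now rewrite E.
  - destruct (sep _ _ Hy Ey) as (r & Hr & HT). exists r; split; [easy|].
    intros T HTc E; apply (HT T HTc); now rewrite E.
  - destruct (sep _ _ Hx Ex) as (r & Hr & HT). exists r; split; [easy|].
    intros T HTc E; apply (HT T HTc); now rewrite E.
Qed.

(** * Generic angles by a Cantor scheme *)

(** The side conditions sit inside the predicate, so it can be imposed on every triple of a finite
    list without filtering. *)
Definition avoids (T : nat -> R) (c : list (nat * bool) * pt * pt) : Prop :=
  let '(L, w, w') := c in
  L <> [] -> reduced L -> on_sphere w -> act T L w <> w'.

Definition nested (t : nat -> R) (r : R) (t' : nat -> R) (r' : R) : Prop :=
  forall u x, Rabs (x - t' u) <= r' -> Rabs (x - t u) <= r.

Lemma avoid_one (c : list (nat * bool) * pt * pt) (t : nat -> R) (r : R) :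
  0 < r -> exists t' r', 0 < r' /\ nested t r t' r' /\
    forall T, close t' T r' -> avoids T c.
Proof.
  intros Hr. destruct c as [[L w] w'].
  destruct (classic (L <> [] /\ reduced L /\ on_sphere w)) as [(H1 & H2 & H3)|H].
  - destruct (bad_angles_nowhere_dense t (r / 2) L w w') as (t' & Ht' & Hne);
      try easy; [lra|].
    destruct (bad_angles_closed L w w' t' Hne) as (r1 & Hr1 & HT).
    exists t', (Rmin r1 (r / 2)).
    assert (Hl := Rmin_l r1 (r / 2)). assert (Hm := Rmin_r r1 (r / 2)).
    repeat split.
    + apply Rmin_glb_lt; lra.
    + intros u x Hx. specialize (Ht' u).
      replace (x - t u) with ((x - t' u) + (t' u - t u)) by ring.
      eapply Rle_trans; [apply Rabs_triang|]; lra.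
    + intros T HTc _ _ _. apply HT. intros u; specialize (HTc u); lra.
  - exists t, r; repeat split; [easy | intros u x; tauto |].
    intros T _ H1 H2 H3; exfalso; tauto.
Qed.

Lemma avoid_list (C : list (list (nat * bool) * pt * pt)) (t : nat -> R) (r : R) :
  0 < r -> exists t' r', 0 < r' /\ nested t r t' r' /\
    forall T, close t' T r' -> forall c, In c C -> avoids T c.
Proof.
  revert t r; induction C as [|c C IH]; intros t r Hr.
  - exists t, r; repeat split; [easy | intros u x; tauto | easy].
  - destruct (avoid_one c t r Hr) as (t1 & r1 & Hr1 & Hn1 & H1).
    destruct (IH t1 r1 Hr1) as (t2 & r2 & Hr2 & Hn2 & H2).
    exists t2, r2; repeat split; [easy | intros u x Hx; now apply Hn1, Hn2 |].
    intros T HT c' [<-|Hc'].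
    + apply H1. intros u; apply Hn2, HT.
    + now apply H2.
Qed.

Fixpoint words {A : Type} (n : nat) (alphabet : list A) : list (list A) :=
  match n with
  | O => [[]]
  | S n => [] :: flat_map (fun a => map (cons a) (words n alphabet)) alphabet
  end.

Lemma in_words {A : Type} (n : nat) (alphabet L : list A) :
  (length L <= n)%nat -> (forall a, In a L -> In a alphabet) ->
  In L (words n alphabet).
Proof.
  revert L; induction n as [|n IH]; intros [|a L] Hlen Hin; simpl in *;
    try (now left).
  right. apply in_flat_map. exists a; split; [apply Hin; now left|].
  apply in_map, IH; [lia|]. intros b Hb; apply Hin; now right.
Qed.

(** Only finitely many conditions belong to level [k], and each condition belongs to all
    sufficiently deep levels. *)
Definition settled (f : nat -> pt) (k : nat) (t : nat -> R) (r : R) : Prop :=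
  forall L n m, (length L <= k)%nat -> (n <= k)%nat -> (m <= k)%nat ->
    (forall u e, In (u, e) L -> (u < 2 ^ k)%nat) ->
    forall T, close t T r -> avoids T (L, f n, f m).

(* The node [u] of one level of the scheme has the children [2u] and [2u+1]. *)
Lemma next_level (f : nat -> pt) (k : nat) (t : nat -> R) (r : R) :
  0 < r -> exists t' r', 0 < r' /\ nested (fun u => t (u / 2)%nat) r t' r' /\
    settled f k t' r'.
Proof.
  intros Hr. set (pts := map f (seq 0 (S k))).
  destruct (avoid_list
    (list_prod (list_prod (words k (list_prod (seq 0 (2 ^ k)) [true; false])) pts) pts)
    (fun u => t (u / 2)%nat) r Hr) as (t' & r' & Hr' & Hn & H).
  exists t', r'; repeat split; [easy | easy |].
  intros L n m HL Hkn Hkm Hu T HT. apply (H T HT).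
  apply in_prod; [apply in_prod |].
  - apply in_words; [easy|]. intros [u e] Hin; apply in_prod.
    + apply in_seq; specialize (Hu u e Hin); lia.
    + destruct e; simpl; tauto.
  - apply in_map, in_seq; lia.
  - apply in_map, in_seq; lia.
Qed.

(** * Limits of nested intervals and codes of 0-1 sequences *)

Lemma nested_intervals (c r : nat -> R) :
  (forall n, 0 < r n) ->
  (forall n x, Rabs (x - c (S n)) <= r (S n) -> Rabs (x - c n) <= r n) ->
  exists x, forall n, Rabs (x - c n) <= r n.
Proof.
  intros Hr Hn.
  assert (Hmono : forall n m x, (n <= m)%nat ->
            Rabs (x - c m) <= r m -> Rabs (x - c n) <= r n).
  { intros n m x Hle; induction Hle as [|m Hle IH]; auto. }
  assert (Hcross : forall n m, c m - r m <= c n + r n).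
  { intros n m. set (k := Nat.max n m).
    assert (Hk : Rabs (c k - c k) <= r k)
      by (rewrite Rminus_diag, Rabs_R0; apply Rlt_le, Hr).
    assert (H1 := Hmono n k (c k) ltac:(lia) Hk).
    assert (H2 := Hmono m k (c k) ltac:(lia) Hk).
    apply Rabs_le_between in H1, H2; lra. }
  destruct (completeness (fun y => exists n, y = c n - r n)) as [x [Hub Hlub]].
  - exists (c 0%nat + r 0%nat); intros y [n ->]; apply Hcross.
  - now exists (c 0%nat - r 0%nat), 0%nat.
  - exists x; intros n. apply Rabs_le_between.
    assert (c n - r n <= x) by (apply Hub; now exists n).
    assert (x <= c n + r n) by (apply Hlub; intros y [m ->]; apply Hcross).
    lra.
Qed.

(** The newest bit is the lowest one, so halving the code gives the parent node in the tree. *)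
Fixpoint code (s : nat -> bool) (k : nat) : nat :=
  match k with O => O | S k => (Nat.b2n (s k) + 2 * code s k)%nat end.

Lemma code_lt (s : nat -> bool) (k : nat) : (code s k < 2 ^ k)%nat.
Proof.
  induction k as [|k IH]; cbn [code Nat.pow]; [lia|].
  assert (Nat.b2n (s k) <= 1)%nat by (destruct (s k); simpl; lia). lia.
Qed.

Lemma code_inj (s s' : nat -> bool) (k i : nat) :
  code s k = code s' k -> (i < k)%nat -> s i = s' i.
Proof.
  induction k as [|k IH]; cbn [code]; intros E Hi; [lia|].
  assert (code s k = code s' k /\ s k = s' k) as [E1 E2].
  { destruct (s k), (s' k); cbn [Nat.b2n] in E; split; (reflexivity || lia). }
  destruct (Nat.eq_dec i k) as [->|]; [easy|]. apply IH; [easy|lia].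
Qed.

(** This gives the distinct letters of a word distinct nodes at all deep levels. *)
Lemma prefix_separates (l : list (nat -> bool)) :
  exists K, forall s s', In s l -> In s' l ->
    (forall i, (i < K)%nat -> s i = s' i) -> s = s'.
Proof.
  assert (H1 : forall (s : nat -> bool) l', exists K, forall s', In s' l' ->
            (forall i, (i < K)%nat -> s i = s' i) -> s = s').
  { intros s l'; induction l' as [|a l' [K HK]]; [now exists 0%nat|].
    destruct (classic (s = a)) as [E|E].
    - exists K; intros s' [<-|Hs'] Hi; auto.
    - assert (exists i, s i <> a i) as [i Hi].
      { apply not_all_ex_not; intros Hall; apply E.
        now apply functional_extensionality. }
      exists (K + S i)%nat; intros s' [<-|Hs'] Heq.
      + exfalso; apply Hi, Heq; lia.
      + apply HK; [easy|]. intros j Hj; apply Heq; lia. }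
  assert (H2 : forall l', exists K, forall s s', In s l' -> In s' l ->
            (forall i, (i < K)%nat -> s i = s' i) -> s = s').
  { intros l'; induction l' as [|a l' [K HK]]; [now exists 0%nat|].
    destruct (H1 a l) as [K' HK'].
    exists (K + K')%nat; intros s s' [<-|Hs] Hs' Heq.
    - apply HK'; [easy|]. intros j Hj; apply Heq; lia.
    - apply HK; [easy | easy |]. intros j Hj; apply Heq; lia. }
  apply H2.
Qed.

Definition relabel {I J : Type} (g : I -> J) (L : list (I * bool)) : list (J * bool) :=
  map (fun x => (g (fst x), snd x)) L.

Lemma act_relabel {I J : Type} (g : I -> J) (t : I -> R) (T : J -> R)
    (L : list (I * bool)) (p : pt) :
  (forall s, In s (map fst L) -> T (g s) = t s) ->
  act T (relabel g L) p = act t L p.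
Proof.
  induction L as [|[u e] L IH]; intros H; [easy|].
  simpl. rewrite H by now left. rewrite IH; [easy|].
  intros s Hs; apply H; now right.
Qed.

Lemma reduced_relabel {I J : Type} (g : I -> J) (L : list (I * bool)) :
  (forall s s', In s (map fst L) -> In s' (map fst L) -> g s = g s' -> s = s') ->
  reduced L -> reduced (relabel g L).
Proof.
  induction L as [|[u e] L IH]; intros Hg Hred; [easy|].
  destruct L as [|[u' e'] L]; [easy|].
  destruct Hred as [H1 H2]. split.
  - intros E. apply H1, Hg; [now left | now right; left | easy].
  - apply IH; [|easy]. intros s s' Hs Hs'; apply Hg; now right.
Qed.

Lemma exists_generic_angles (f : nat -> pt) :
  exists phi : (nat -> bool) -> R, forall L n m,
    L <> [] -> reduced L -> on_sphere (f n) -> act phi L (f n) <> f m.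
Proof.
  set (state := {x : (nat -> R) * R | 0 < snd x}).
  assert (Hstep : forall k (x : state), exists y : state,
    nested (fun u => fst (proj1_sig x) (u / 2)%nat) (snd (proj1_sig x))
           (fst (proj1_sig y)) (snd (proj1_sig y)) /\
    settled f (S k) (fst (proj1_sig y)) (snd (proj1_sig y))).
  { intros k [[t r] Hr]; simpl in *.
    destruct (next_level f (S k) t r Hr) as (t' & r' & Hr' & H).
    now exists (exist _ (t', r') Hr'). }
  (* Choice fixes the refinement of each box; the positive radius is part of the state so that the
     refinement can be iterated. *)
  set (next := fun k x => constructive_indefinite_description _ (Hstep k x)).
  set (level := fix level (k : nat) : state :=
    match k with
    | O => exist _ (fun _ => 0, 1) Rlt_0_1
    | S k => proj1_sig (next k (level k))
    end).
  set (t := fun k => fst (proj1_sig (level k))).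
  set (r := fun k => snd (proj1_sig (level k))).
  assert (Hnest : forall k, nested (fun u => t k (u / 2)%nat) (r k) (t (S k)) (r (S k)))
    by (intros k; exact (proj1 (proj2_sig (next k (level k))))).
  assert (Hset : forall k, settled f (S k) (t (S k)) (r (S k)))
    by (intros k; exact (proj2 (proj2_sig (next k (level k))))).
  assert (Hlim : forall s, exists x, forall k, Rabs (x - t k (code s k)) <= r k).
  { intros s. apply nested_intervals.
    - intros k; exact (proj2_sig (level k)).
    - intros k x Hx. apply Hnest in Hx. cbn [code] in Hx.
      now rewrite Nat.add_b2n_double_div2 in Hx. }
  set (phi := fun s => proj1_sig (constructive_indefinite_description _ (Hlim s))).
  assert (Hphi : forall s k, Rabs (phi s - t k (code s k)) <= r k)
    by (intros s; exact (proj2_sig (constructive_indefinite_description _ (Hlim s)))).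
  clearbody phi t r. clear Hlim Hnest level next Hstep state.
  exists phi; intros L n m HL Hred Hn.
  destruct (prefix_separates (map fst L)) as [K HK].
  set (k := (K + length L + n + m)%nat).
  assert (Hinj : forall s s', In s (map fst L) -> In s' (map fst L) ->
            code s (S k) = code s' (S k) -> s = s').
  { intros s s' Hs Hs' E. apply HK; [easy | easy |].
    intros i Hi. apply (code_inj s s' (S k)); [easy|lia]. }
  (* The angles [T] on nodes agree with [phi] on the letters of the word and take the center of the
     box elsewhere, so they lie in the box that settled the relabeled word. *)
  set (T := fun u => match find (fun s => (code s (S k) =? u)%nat) (map fst L) with
                     | Some s => phi s | None => t (S k) u end).
  assert (HT : forall s, In s (map fst L) -> T (code s (S k)) = phi s).
  { intros s Hs; unfold T.
    destruct (find _ _) as [s'|] eqn:E.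
    - apply find_some in E as [Hs' E]. apply Nat.eqb_eq in E.
      now rewrite (Hinj s' s Hs' Hs E).
    - apply find_none with (x := s) in E; [|easy].
      now rewrite Nat.eqb_refl in E. }
  assert (Hclose : close (t (S k)) T (r (S k))).
  { intros u; unfold T.
    destruct (find _ _) as [s|] eqn:E.
    - apply find_some in E as [_ E]. apply Nat.eqb_eq in E; subst u. apply Hphi.
    - rewrite Rminus_diag, Rabs_R0.
      (* An arbitrary sequence serves to show that the radius is nonnegative. *)
      apply Rle_trans with (2 := Hphi (fun _ => false) (S k)). apply Rabs_pos. }
  rewrite <- (act_relabel (fun s => code s (S k)) phi T) by easy.
  apply (Hset k (relabel (fun s => code s (S k)) L) n m); try easy; try lia.
  - unfold relabel; rewrite length_map; lia.
  - intros u e Hin. apply in_map_iff in Hin as [[s e'] [E _]].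
    injection E as <- _. exact (code_lt s (S k)).
  - destruct L; [contradiction | discriminate].
  - now apply reduced_relabel.
Qed.

(** * Coloring the branches *)

(** Here [s] is both the label of a generator and a coloring of the indices. A branch starts with
    the color its label gives to the root and grows only through points outside [W]. *)
Inductive red (W : pt -> Prop) (f : nat -> pt) (phi : (nat -> bool) -> R) : pt -> Prop :=
| red_root s e n : W (f n) -> s n = true -> red W f phi (gen (phi s) e (f n))
| red_edge s e p : red W f phi p -> ~ W p -> red W f phi (gen (phi s) e p).

Lemma red_word (W : pt -> Prop) (f : nat -> pt) (phi : (nat -> bool) -> R) (p : pt) :
  red W f phi p -> ~ W p ->
  exists L s e n, p = act phi (L ++ [(s, e)]) (f n) /\
    reduced (L ++ [(s, e)]) /\ W (f n) /\ s n = true.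
Proof.
  induction 1 as [s e n Hn Hs | s0 e0 p Hred IH Hp]; intros Hnew.
  - exists [], s, e, n; simpl; tauto.
  - destruct (IH Hp) as (L & s & e & n & -> & HL & Hn & Hs).
    (* If the new letter cancels the head, the path is shortened; cancelling the only letter would
       lead back to the root, which is in [W]. *)
    destruct (classic (exists L', L ++ [(s, e)] = (s0, negb e0) :: L'))
      as [[L' E]|E].
    + destruct L as [|x L]; injection E as -> E.
      * subst e. exfalso; apply Hnew. simpl.
        rewrite <- (Bool.negb_involutive e0) at 1. now rewrite gen_cancel.
      * exists L, s, e, n; repeat split; try easy.
        -- simpl. rewrite <- (Bool.negb_involutive e0) at 1. now rewrite gen_cancel.
        -- apply HL.
    + exists ((s0, e0) :: L), s, e, n; split; [easy | split; [|easy]].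
      change (((s0, e0) :: L) ++ [(s, e)]) with ((s0, e0) :: (L ++ [(s, e)])).
      split; [|easy].
      destruct (L ++ [(s, e)]) as [|[u e1] L'] eqn:EL; [easy|].
      intros <-. destruct e0, e1; try easy; exfalso; apply E; now exists L'.
Qed.

(** Closing the red path by the edge back to [f n] gives a word from [W] to [W]. Genericity leaves
    only the path consisting of that same edge. The index [m] may differ from [n] since [f] may
    repeat values. *)
Lemma red_neighbor (W : pt -> Prop) (f : nat -> pt) (phi : (nat -> bool) -> R)
    (s : nat -> bool) (e : bool) (n : nat) :
  (forall L p q, L <> [] -> reduced L -> W p -> W q -> act phi L p <> q) ->
  W (f n) -> red W f phi (gen (phi s) e (f n)) ->
  exists m, f m = f n /\ s m = true.
Proof.
  intros Hgen Hn Hr.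
  assert (Hout : ~ W (gen (phi s) e (f n))).
  { intros Hq. now apply (Hgen [(s, e)] (f n) (gen (phi s) e (f n))). }
  destruct (red_word W f phi _ Hr Hout) as (L & s' & e' & m & E & HL & Hm & Hs').
  assert (Hback : act phi ((s, negb e) :: (L ++ [(s', e')])) (f m) = f n)
    by (simpl; rewrite <- E; apply gen_cancel).
  destruct (classic (exists L', L ++ [(s', e')] = (s, e) :: L')) as [[L' EL]|EL].
  - destruct L as [|x L]; injection EL as -> EL.
    + subst. exists m; split; [|easy].
      apply (f_equal (gen (phi s) (negb e))) in E.
      simpl in E. now rewrite !gen_cancel in E.
    + exfalso. simpl in Hback. rewrite gen_cancel in Hback.
      apply (Hgen (L ++ [(s', e')]) (f m) (f n)); try easy; [|apply HL].
      now destruct L.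
  - exfalso. apply (Hgen _ (f m) (f n)) in Hback; try easy.
    split; [|easy].
    destruct (L ++ [(s', e')]) as [|[u e1] L'] eqn:E1; [easy|].
    intros <-. destruct e, e1; try easy; exfalso; apply EL; now exists L'.
Qed.

(** * Generators as matrices, and the invariance of every extension *)

Definition gen_mat (t : R) : mat3 :=
  let c := cos t in let s := sin t in
  Mat3 (c * c + 3 / 5 * (s * s)) (2 / 5 * (c * s)) (4 / 5 * s)
       (2 / 5 * (c * s)) (s * s + 3 / 5 * (c * c)) (- (4 / 5 * c))
       (- (4 / 5 * s)) (4 / 5 * c) (3 / 5).

Lemma gen_mat_apply (t : R) (p : pt) : mat_apply (gen_mat t) p = gen t true p.
Proof.
  destruct p as [[x y] z]. unfold gen; cbn; rewrite cos_neg, sin_neg.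
  apply pt_eq; field.
Qed.

Lemma gen_mat_SO3 (t : R) : in_SO3 (gen_mat t).
Proof.
  assert (Hcs := cos_sin_sqr t).
  (* These rules lower the powers of the cosine, so that entries can be compared as polynomials. *)
  assert (H2 : cos t ^ 2 = 1 - sin t ^ 2) by (rewrite <- !Rsqr_pow2; exact Hcs).
  assert (H3 : cos t ^ 3 = cos t * (1 - sin t ^ 2)) by (rewrite <- H2; ring).
  assert (H4 : cos t ^ 4 = (1 - sin t ^ 2) ^ 2) by (rewrite <- H2; ring).
  split.
  - unfold mat_mul, mat_tr, mat_id, gen_mat; cbn.
    f_equal; field_simplify; rewrite ?H4, ?H3, ?H2; field.
  - unfold mat_det, gen_mat; cbn.
    field_simplify; rewrite ?H4, ?H3, ?H2; field.
Qed.

Lemma countable_precoloring (W : pt -> Prop) :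
  subset_sphere W -> countable_set W ->
  exists c0 : coloring, forall c, extends W c0 c -> ~ distinguishing c.
Proof.
  intros HW [f Hf]. destruct (exists_generic_angles f) as [phi Hphi].
  assert (Hgen : forall L p q, L <> [] -> reduced L -> W p -> W q -> act phi L p <> q).
  { intros L p q HL Hr Hp Hq.
    destruct (Hf p Hp) as [n <-], (Hf q Hq) as [m <-]. apply Hphi; auto. }
  exists (fun p => if excluded_middle_informative (red W f phi p) then true else false).
  (* The extension names the rotation that defeats it: [s] records its colors along the
     enumeration. *)
  intros c Hext Hdist. set (s := fun n => c (f n)).
  assert (Hc : forall p, on_sphere p -> ~ W p -> (c p = true <-> red W f phi p)).
  { intros p Hp HWp. rewrite (Hext p Hp HWp).
    destruct (excluded_middle_informative _); split; easy. }
  assert (Hsph : forall e p, on_sphere p -> on_sphere (gen (phi s) e p))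
    by (intros e p; rewrite !on_sphere_inner, gen_inner; easy).
  assert (HcW : forall e p, W p -> c (gen (phi s) e p) = c p).
  { intros e p Hp. destruct (Hf p Hp) as [n <-].
    assert (Hout : ~ W (gen (phi s) e (f n)))
      by (intros Hq; now apply (Hgen [(s, e)] (f n) (gen (phi s) e (f n)))).
    apply Bool.eq_true_iff_eq.
    rewrite (Hc _ (Hsph e _ (HW _ Hp)) Hout). split; intros H.
    - destruct (red_neighbor W f phi s e n Hgen Hp H) as (m & E & Hm).
      unfold s in Hm. now rewrite <- E.
    - now apply red_root. }
  assert (Hid : gen_mat (phi s) = mat_id).
  { apply Hdist; [apply gen_mat_SO3|]. intros p Hp. rewrite gen_mat_apply.
    (* An edge with an end in [W] is handled by [HcW], read backwards if that end is the target.
       Away from [W], redness passes along the edge in both directions. *)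
    destruct (classic (W p)) as [HWp|HWp]; [now apply HcW|].
    assert (Hback : gen (phi s) false (gen (phi s) true p) = p)
      by apply (gen_cancel (phi s) true).
    destruct (classic (W (gen (phi s) true p))) as [HWq|HWq].
    - rewrite <- Hback at 2. symmetry; now apply HcW.
    - apply Bool.eq_true_iff_eq. rewrite (Hc _ (Hsph true _ Hp) HWq), (Hc _ Hp HWp).
      split; intros H; [|now apply red_edge].
      rewrite <- Hback. now apply red_edge. }
  (* The generator is not the identity, because its last entry is 3/5. *)
  apply (f_equal m33) in Hid. simpl in Hid. lra.
Qed.

Lemma finite_countable (W : pt -> Prop) : finite_set W -> countable_set W.
Proof.
  (* The default [pole] pads the enumeration past the list, which is harmless since [f] only has to
     cover [W]. *)
  intros [l Hl]. exists (fun n => nth n l pole). intros p Hp.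
  destruct (In_nth l p pole (Hl p Hp)) as (n & _ & E). now exists n.
Qed.

Lemma countable_not_P (W : pt -> Prop) :
  subset_sphere W -> countable_set W ->
  (exists c0 : coloring, forall c, extends W c0 c -> ~ distinguishing c)
  /\ ~ P_prop W.
Proof.
  intros HW Hc. destruct (countable_precoloring W HW Hc) as [c0 H0].
  split; [now exists c0|]. intros HP. destruct (HP c0) as (c & He & Hd).
  exact (H0 c He Hd).
Qed.

Theorem theorem4 :
  (forall W : pt -> Prop, subset_sphere W -> finite_set W ->
     (exists c0 : coloring, forall c, extends W c0 c -> ~ distinguishing c)
     /\ ~ P_prop W)
  /\
  (forall W : pt -> Prop, subset_sphere W -> countable_set W ->
     (exists c0 : coloring, forall c, extends W c0 c -> ~ distinguishing c)
     /\ ~ P_prop W).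
Proof.
  split; intros W HW H; apply countable_not_P; try easy.
  now apply finite_countable.
Qed.
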